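(* Let $\mathcal{R}$ be the class of all random Apollonian network structures, and let $$\Delta(z,d_{(1)},d_{(2)},d_{(3)})=\sum_{R\in\mathcal{R}} d_{(1)}^{\Delta_{(1)}(R)}\,d_{(2)}^{\Delta_{(2)}(R)}\,d_{(3)}^{\Delta_{(3)}(R)}\,z^{|R|}$$ be the topological generating function. It satisfies the recursive equation $$\Delta(z,d_{(1)},d_{(2)},d_{(3)})=1+z\,d_{(1)}d_{(2)}d_{(3)}\times\Delta(z d_{(1)},d_{(2)},d_{(3)},d_{(1)})\times\Delta(z,d_{(1)},d_{(2)}d_{(3)},1)\times\Delta(z,d_{(1)}d_{(2)},d_{(3)},1).$$
   Context: A random Apollonian network structure (RANS) $R$ is defined recursively: it is either an empty triangle with ordered vertices $O_1(R),O_2(R),O_3(R)$ (mutually adjacent), or such a triangle together with a new vertex $c$ (the center of $R$) placed inside and joined to $O_1,O_2,O_3$, each of the three resulting sub-triangles being substituted by a RANS. The sub-RANS are $S_1(R),S_2(R),S_3(R)$, where $S_i(R)$ is the one whose triangle does not contain $O_i(R)$; the $i$-th outermost vertex of $S_i(R)$ is $c$ and its other outermost vertices are $O_j(R)$ in position $j$, $j\neq i$. $\mathcal{O}(R)=\{O_1(R),O_2(R),O_3(R)\}$ is the set of outermost vertices; all other vertices are internal. The order $|R|$ is the number of internal vertices (the empty RANS has order $0$; otherwise the order is one plus the sum of the orders of the sub-RANS). RANS of order $n$ are in bijection with plane ternary trees with $n$ internal nodes. With $d$ the graph distance in $R$ (distance to a set being the minimum distance to its elements), and with sums over the internal vertices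 $x$ of $R$: $\Delta_{(1)}(R)=\sum_x d(x,O_1(R))$, $\Delta_{(2)}(R)=\sum_x d(x,\{O_1(R),O_2(R)\})$, $\Delta_{(3)}(R)=\sum_x d(x,\mathcal{O}(R))$. The generating function is a formal power series in $z$ with coefficients polynomial in $d_{(1)},d_{(2)},d_{(3)}$. *)

(* Defs.v *)
From HB Require Import structures.
From mathcomp Require Import all_boot all_algebra.
From mathcomp.multinomials Require Import mpoly.

Set Implicit Arguments.
Unset Strict Implicit.
Unset Printing Implicit Defensive.

Import GRing.Theory.

(* A random Apollonian network structure: an empty triangle, or a triangle with
   a center and the three sub-RANS S_1, S_2, S_3. *)
Inductive rans : Type :=
  | Empty
  | Node of rans & rans & rans.

Fixpoint rans_encode (R : rans) : GenTree.tree void :=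
  match R with
  | Empty => GenTree.Node 0 [::]
  | Node S1 S2 S3 =>
      GenTree.Node 1 [:: rans_encode S1; rans_encode S2; rans_encode S3]
  end.

Fixpoint rans_decode (t : GenTree.tree void) : option rans :=
  match t with
  | GenTree.Node 0 [::] => Some Empty
  | GenTree.Node 1 [:: t1; t2; t3] =>
      match rans_decode t1, rans_decode t2, rans_decode t3 with
      | Some S1, Some S2, Some S3 => Some (Node S1 S2 S3)
      | _, _, _ => None
      end
  | _ => None
  end.

Lemma rans_encodeK : pcancel rans_encode rans_decode.
Proof. by elim=> //= S1 -> S2 -> S3 ->. Qed.

HB.instance Definition _ := Countable.copy rans (pcan_type rans_encodeK).

Fixpoint rans_order (R : rans) : nat :=
  match R with
  | Empty => 0
  | Node S1 S2 S3 => (rans_order S1 + rans_order S2 + rans_order S3).+1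
  end.

(* Internal vertices; [None] is the center of a nonempty RANS. *)
Fixpoint internal (R : rans) : finType :=
  match R with
  | Empty => void
  | Node S1 S2 S3 => option (internal S1 + internal S2 + internal S3)%type
  end.

Lemma card_internal (R : rans) : #|internal R| = rans_order R.
Proof.
elim: R => [|S1 IH1 S2 IH2 S3 IH3] /=; first exact: card_void.
by rewrite card_option !card_sum IH1 IH2 IH3.
Qed.

(* The three outermost vertices O_1, O_2, O_3 are [inl 0], [inl 1], [inl 2]. *)
Definition vertex (R : rans) : finType := ('I_3 + internal R)%type.

Definition i1 : 'I_3 := @Ordinal 3 0 isT.
Definition i2 : 'I_3 := @Ordinal 3 1 isT.
Definition i3 : 'I_3 := @Ordinal 3 2 isT.

Definition O1 (R : rans) : vertex R := inl i1.
Definition O2 (R : rans) : vertex R := inl i2.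
Definition O3 (R : rans) : vertex R := inl i3.

(* Substituting a RANS with internal vertices [I] for the [i]-th sub-triangle:
   its [i]-th outermost vertex becomes the center, its [j]-th one, [j != i],
   becomes O_j, and its internal vertices are included through [f]. *)
Definition substitute (I J : finType) (i : 'I_3) (f : I -> J)
    (v : 'I_3 + I) : 'I_3 + option J :=
  match v with
  | inl j => if j == i then inr None else inl j
  | inr x => inr (Some (f x))
  end.

Definition sub1 (S1 S2 S3 : rans) : vertex S1 -> vertex (Node S1 S2 S3) :=
  substitute i1
    (fun x => inl (inl x) : (internal S1 + internal S2 + internal S3)%type).
Definition sub2 (S1 S2 S3 : rans) : vertex S2 -> vertex (Node S1 S2 S3) :=
  substitute i2
    (fun x => inl (inr x) : (internal S1 + internal S2 + internal S3)%type).
Definition sub3 (S1 S2 S3 : rans) : vertex S3 -> vertex (Node S1 S2 S3) :=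
  substitute i3
    (fun x => inr x : (internal S1 + internal S2 + internal S3)%type).

Definition outer_adj (R : rans) : rel (vertex R) := fun x y =>
  match x, y with
  | inl i, inl j => i != j
  | _, _ => false
  end.

Definition center_adj (S1 S2 S3 : rans) : rel (vertex (Node S1 S2 S3)) :=
  fun x y =>
  match x, y with
  | inr None, inl _ | inl _, inr None => true
  | _, _ => false
  end.

(* The image of the relation [e] under [f]. *)
Definition image_rel (T U : finType) (f : T -> U) (e : rel T) : rel U :=
  fun x y => [exists x', exists y', [&& f x' == x, f y' == y & e x' y']].

Fixpoint adj (R : rans) : rel (vertex R) :=
  match R with
  | Empty => @outer_adj Empty
  | Node S1 S2 S3 => fun x y =>
      [|| outer_adj x y,
          center_adj x y,
          image_rel (@sub1 S1 S2 S3) (@adj S1) x y,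
          image_rel (@sub2 S1 S2 S3) (@adj S2) x y
        | image_rel (@sub3 S1 S2 S3) (@adj S3) x y]
  end.

(* The graph distance, i.e. the least length of a path from [x] to [y]. Shortest
   paths have length less than [#|T|], which is the (never attained) value of
   the distance between vertices in different components. *)
Definition graph_dist (T : finType) (e : rel T) (x y : T) : nat :=
  find (fun n => [exists p : n.-tuple T, path e x p && (last x p == y)])
       (iota 0 #|T|).

Definition graph_dist_set (T : finType) (e : rel T) (x : T) (A : {set T}) : nat
  := \big[minn/#|T|]_(y in A) graph_dist e x y.

Lemma graph_dist_le (T : finType) (e : rel T) (x y : T) (p : seq T) :
  path e x p -> last x p = y -> graph_dist e x y <= size p.
Proof.
rewrite /graph_dist; move=> xp lp.
have [sp|sp] := ltnP (size p) #|T|; last first.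
  by rewrite (leq_trans (find_size _ _)) // size_iota.
rewrite leqNgt; apply/negP => lt_p.
have := before_find 0 lt_p; rewrite nth_iota // add0n => /negbT/negP[].
by apply/existsP; exists (in_tuple p); rewrite xp lp eqxx.
Qed.

Lemma graph_dist_path (T : finType) (e : rel T) (x y : T) : connect e x y ->
  exists p, [/\ path e x p, last x p = y & size p = graph_dist e x y].
Proof.
case/connectP=> p0 /shortenP[p xp up _] ->.
have sp : size p < #|T| by have := max_card (mem (x :: p)); rewrite (card_uniqP up).
have lt_d : graph_dist e x (last x p) < #|T|.
  by apply: leq_ltn_trans sp; apply: graph_dist_le.
have /(nth_find 0) : has (fun n =>
    [exists q : n.-tuple T, path e x q && (last x q == last x p)]) (iota 0 #|T|).
  by rewrite has_find size_iota.
rewrite nth_iota // add0n => /existsP[q /andP[xq /eqP lq]].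
by exists q; rewrite size_tuple.
Qed.

Definition distR (R : rans) (x : vertex R) (A : {set vertex R}) : nat :=
  graph_dist_set (@adj R) x A.

Definition Delta1 (R : rans) : nat :=
  \sum_(x : internal R) distR (inr x) [set O1 R].
Definition Delta2 (R : rans) : nat :=
  \sum_(x : internal R) distR (inr x) [set O1 R; O2 R].
Definition Delta3 (R : rans) : nat :=
  \sum_(x : internal R) distR (inr x) [set O1 R; O2 R; O3 R].

(* The finite type of all RANS of rans_order [n]. *)
Record rans_of (n : nat) : Type :=
  RansOf { rans_val :> rans; rans_valP : rans_order rans_val == n }.

HB.instance Definition _ (n : nat) := [isSub for @rans_val n].
HB.instance Definition _ (n : nat) := [Countable of rans_of n by <:].

Fixpoint rans_upto (k : nat) : seq rans :=
  if k is k'.+1 then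
    Empty :: [seq Node t.1 t.2.1 t.2.2 |
              t <- [seq (S1, S23) | S1 <- rans_upto k',
                    S23 <- [seq (S2, S3) | S2 <- rans_upto k',
                                           S3 <- rans_upto k']]]
  else [:: Empty].

Lemma mem_rans_upto (k : nat) (R : rans) : rans_order R <= k -> R \in rans_upto k.
Proof.
elim: k R => [|k IH] [|S1 S2 S3] //; rewrite /= ltnS => le_k.
have [le12 le3] : rans_order S1 + rans_order S2 <= k /\ rans_order S3 <= k.
  by split; apply: leq_trans le_k; rewrite ?leq_addr ?leq_addl.
rewrite inE /=; apply/mapP; exists (S1, (S2, S3)) => //.
apply: allpairs_f; first by rewrite IH // (leq_trans _ le12) ?leq_addr.
by apply: allpairs_f; rewrite IH // (leq_trans _ le12) ?leq_addl.
Qed.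

Definition rans_of_enum (n : nat) : seq (rans_of n) :=
  undup (pmap insub (rans_upto n)).

Lemma rans_of_enumP (n : nat) : Finite.axiom (rans_of_enum n).
Proof.
move=> R; rewrite count_uniq_mem ?undup_uniq // mem_undup mem_pmap_sub.
by rewrite mem_rans_upto // (eqP (rans_valP R)).
Qed.

HB.instance Definition _ (n : nat) := isFinite.Build (rans_of n) (@rans_of_enumP n).

Local Open Scope ring_scope.

(* Formal power series in [z], given by their sequence of coefficients. *)
Definition fps (A : Type) : Type := nat -> A.

Declare Scope fps_scope.
Delimit Scope fps_scope with fps.
Bind Scope fps_scope with fps.

Definition fps_const (A : pzRingType) (a : A) : fps A :=
  fun n => if n == 0%N then a else 0.
Definition fps_z (A : pzRingType) : fps A := fun n => if n == 1%N then 1 else 0.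
Definition fps_add (A : pzRingType) (F G : fps A) : fps A := fun n => F n + G n.
Definition fps_mul (A : pzRingType) (F G : fps A) : fps A :=
  fun n => \sum_(k < n.+1) F k * G (n - k)%N.

Arguments fps_const {A} a%_R n%_N.
Arguments fps_z {A} n%_N.

Notation "F + G" := (fps_add F G) : fps_scope.
Notation "F * G" := (fps_mul F G) : fps_scope.
Notation "1" := (fps_const 1%R) : fps_scope.

Notation poly3 := {mpoly int[3]}.

Definition d1 : poly3 := 'X_i1.
Definition d2 : poly3 := 'X_i2.
Definition d3 : poly3 := 'X_i3.

(* F(z q, p1, p2, p3), for F(z, d1, d2, d3) a power series in [z] with
   coefficients in Z[d1, d2, d3]. *)
Definition fps_subst (F : fps poly3) (q p1 p2 p3 : poly3) : fps poly3 :=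
  fun n => (F n \mPo [tuple p1; p2; p3]) * q ^+ n.

Arguments fps_subst F (q p1 p2 p3)%_R n%_N.

Definition Delta : fps poly3 := fun n =>
  \sum_(R : rans_of n) d1 ^+ Delta1 R * d2 ^+ Delta2 R * d3 ^+ Delta3 R.

(* Main.v *)
Require Import Defs.
From mathcomp Require Import all_boot all_algebra.
From mathcomp Require Import all_order zify ring.
From mathcomp.multinomials Require Import mpoly.

Set Implicit Arguments.
Unset Strict Implicit.
Unset Printing Implicit Defensive.

Import Order.TTheory GRing.Theory.

(** Every distance occurring in the three statistics is the distance to a set of
    outermost vertices, and all of them can be computed by one recursion.  Label
    the outermost vertices by 0 if they are targets and by 1 otherwise, label
    the center of a triangle by one more than the least label of its corners,
    and go on in the three sub-triangles with the labels of their corners.  The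
    resulting label of a vertex is its distance to the targets: labels change by
    at most one along an edge ([vlabel_lip]), and every internal vertex has a
    neighbor with the label just below ([label_desc]), as has every outermost
    vertex that is no target, so that [graph_dist_setE] applies.  Paths that
    leave a sub-RANS thus never need to be examined.

    Write [H R a b c] for the sum of the labels of the internal vertices when
    the corners are labelled a, b, c; then Delta_(1), Delta_(2), Delta_(3) are
    [H R 0 1 1], [H R 0 0 1] and [H R 0 0 0].  In each case the center gets the
    label 1, hence
<<
      H R 0 1 1 = 1 + H S1 1 1 1 + H S2 0 1 1 + H S3 0 1 1
      H R 0 0 1 = 1 + H S1 1 0 1 + H S2 0 1 1 + H S3 0 0 1
      H R 0 0 0 = 1 + H S1 1 0 0 + H S2 0 1 0 + H S3 0 0 1
>>
    Now [H S1 1 1 1] is [H S1 0 0 0 + |S1|], which accounts for the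
    substitution of z d_(1) for z, and renaming the corners, which permutes the
    RANS of each order, permutes the arguments a, b, c of [H].  So every term on the
    right is one of the three statistics of a renamed sub-RANS: S1 contributes
    (Delta_(3) + order, Delta_(1), Delta_(2)), S2 contributes (Delta_(1),
    Delta_(1), Delta_(2)) and S3 contributes (Delta_(1), Delta_(2), Delta_(2)).
    The weight of R is therefore the weight d_(1) d_(2) d_(3) of the center
    times a product of weights of the sub-RANS, and such a factorization turns
    into a product of power series ([rans_gf_node]). *)

(** * Distances from potentials *)

(** A function that is 1-Lipschitz along the edges bounds distances to its zero
    set from below; if one can moreover always descend by one along an edge, the
    bound is attained. *)
Section Potential.
Variables (T : finType) (e : rel T) (f : T -> nat).
Hypothesis f_lip : forall x y, e x y -> f x <= (f y).+1.

Lemma potential_path x p : path e x p -> f x <= f (last x p) + size p.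
Proof.
elim: p x => [|y p IH] x /=; first by rewrite addn0.
by case/andP=> /f_lip exy /IH; lia.
Qed.

(** The bound by [#|T|] covers the case where [y] is not reachable from [x]. *)
Lemma leq_graph_dist x y : f y = 0 -> f x <= #|T| -> f x <= graph_dist e x y.
Proof.
move=> fy0 le_fx; have [/(leq_trans le_fx)//|lt_d] := leqP #|T| (graph_dist e x y).
have : has (fun n => [exists p : n.-tuple T, path e x p && (last x p == y)])
         (iota 0 #|T|) by rewrite has_find size_iota.
move/(nth_find 0); rewrite nth_iota // add0n => /existsP[p /andP[xp /eqP lp]].
by have := potential_path xp; rewrite lp fy0 size_tuple add0n.
Qed.

Hypothesis f_desc : forall x, 0 < f x -> exists2 y, e x y & f x = (f y).+1.

Lemma potential_descent x :
  exists p, [/\ path e x p, f (last x p) = 0 & size p = f x].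
Proof.
have [n] := ubnP (f x); elim: n x => // n IH x lt_n.
have [fx0|/f_desc[y exy fx]] := posnP (f x); first by exists [::].
have [|p [yp lp sp]] := IH y; first by lia.
by exists (y :: p); rewrite /= exy sp.
Qed.

Lemma graph_dist_setE (A : {set T}) x :
  (forall y, (y \in A) = (f y == 0)) -> graph_dist_set e x A = f x.
Proof.
move=> memA; have [p [xp lp sp]] := potential_descent x.
have le_fx : f x <= #|T|.
  (* A shortest path to the end of the descent is no shorter than [f x]. *)
  have /graph_dist_path[q [xq lq sq]] : connect e x (last x p).
    by apply/connectP; exists p.
  have := potential_path xq; rewrite lq lp add0n sq => /leq_trans-> //.
  by rewrite -[X in _ <= X](size_iota 0) find_size.
rewrite /graph_dist_set -minEnat; apply/eqP; rewrite eqn_leq; apply/andP; split.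
  rewrite -sp -leEnat; apply: (bigmin_inf (last x p)); first by rewrite memA lp.
  by rewrite leEnat graph_dist_le.
rewrite -leEnat; apply: le_bigmin => // y; rewrite memA leEnat => /eqP fy0.
exact: leq_graph_dist.
Qed.

End Potential.

(** * Distances in a RANS by recursion *)

Definition center_label (a b c : nat) : nat := (minn a (minn b c)).+1.

Fixpoint label (R : rans) : nat -> nat -> nat -> internal R -> nat :=
  match R with
  | Empty => fun _ _ _ _ => 0
  | Node S1 S2 S3 => fun a b c x =>
      let m := center_label a b c in
      match x with
      | None => m
      | Some (inl (inl y)) => label m b c y
      | Some (inl (inr y)) => label a m c y
      | Some (inr y) => label a b m y
      end
  end.

Definition vlabel (R : rans) (a b c : nat) (v : vertex R) : nat :=
  match v with
  | inl i => nth 0 [:: a; b; c] i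
  | inr x => label a b c x
  end.

(** [label_sum R a b c] is kept as a recursive function of its own, independent
    of the finite types of vertices, so that shifting and renaming of corners
    become plain inductions. *)
Fixpoint label_sum (R : rans) (a b c : nat) : nat :=
  match R with
  | Empty => 0
  | Node S1 S2 S3 =>
      let m := center_label a b c in
      m + label_sum S1 m b c + label_sum S2 a m c + label_sum S3 a b m
  end.

(** The corners of a triangle are mutually adjacent, so this is what it takes for
    the labels of the corners to be 1-Lipschitz; the recursion preserves it. *)
Definition near (a b c : nat) : bool :=
  [&& a <= b.+1, a <= c.+1, b <= a.+1, b <= c.+1, c <= a.+1 & c <= b.+1].

Lemma near_center a b c (m := center_label a b c) :
  near a b c -> [/\ near m b c, near a m c & near a b m].
Proof. by rewrite /near /m /center_label => near_abc; split; lia. Qed.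

Lemma ord3P (i : 'I_3) : [\/ i = i1, i = i2 | i = i3].
Proof.
by case: i => -[|[|[|]]] // i;
   [constructor 1 | constructor 2 | constructor 3]; apply: val_inj.
Qed.

Section VlabelSub.
Variables (S1 S2 S3 : rans) (a b c : nat).
Let m := center_label a b c.

Lemma vlabel_sub1 v : vlabel a b c (@sub1 S1 S2 S3 v) = vlabel m b c v.
Proof. by case: v => // i; case: (ord3P i) => ->. Qed.

Lemma vlabel_sub2 v : vlabel a b c (@sub2 S1 S2 S3 v) = vlabel a m c v.
Proof. by case: v => // i; case: (ord3P i) => ->. Qed.

Lemma vlabel_sub3 v : vlabel a b c (@sub3 S1 S2 S3 v) = vlabel a b m v.
Proof. by case: v => // i; case: (ord3P i) => ->. Qed.

End VlabelSub.

Definition vlabel_subE := (vlabel_sub1, vlabel_sub2, vlabel_sub3).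

Lemma outer_adj_lip R a b c x y :
  near a b c -> @outer_adj R x y -> vlabel a b c x <= (vlabel a b c y).+1.
Proof.
rewrite /near; case: x => // i; case: y => // j.
case: (ord3P i) => ->; case: (ord3P j) => -> //= + _; lia.
Qed.

Lemma center_adj_lip S1 S2 S3 a b c x y :
  near a b c -> @center_adj S1 S2 S3 x y ->
  vlabel a b c x <= (vlabel a b c y).+1.
Proof.
rewrite /near.
case: x => [i|[|]] //; case: y => [j|[|]] // + _.
  by case: (ord3P i) => -> /=; rewrite /center_label; lia.
by case: (ord3P j) => -> /=; rewrite /center_label; lia.
Qed.

(** All edges of a RANS lie in its outer triangle, join its center to a corner,
    or come from a sub-RANS, whose corners are labelled consistently. *)
Lemma vlabel_lip R a b c x y :
  near a b c -> @adj R x y -> vlabel a b c x <= (vlabel a b c y).+1.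
Proof.
elim: R a b c x y => [|S1 IH1 S2 IH2 S3 IH3] a b c x y near_abc.
  exact: outer_adj_lip.
have [near1 near2 near3] := near_center near_abc.
case/or4P=> [||/existsP[u /existsP[v]]|]; first exact: outer_adj_lip.
- exact: center_adj_lip.
- by case/and3P=> /eqP<- /eqP<- uv; rewrite !vlabel_subE IH1.
case/orP=> /existsP[u /existsP[v /and3P[/eqP<- /eqP<- uv]]].
  by rewrite !vlabel_subE IH2.
by rewrite !vlabel_subE IH3.
Qed.

Lemma image_relT (T U : finType) (f : T -> U) (e : rel T) x y :
  e x y -> image_rel f e (f x) (f y).
Proof. by move=> exy; apply/existsP; exists x; apply/existsP; exists y; rewrite !eqxx. Qed.

Lemma adj_sub1 S1 S2 S3 u v :
  @adj S1 u v -> adj (@sub1 S1 S2 S3 u) (sub1 S2 S3 v).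
Proof. by move=> uv; rewrite /= (image_relT _ uv) !orbT. Qed.

Lemma adj_sub2 S1 S2 S3 u v :
  @adj S2 u v -> adj (@sub2 S1 S2 S3 u) (sub2 S1 S3 v).
Proof. by move=> uv; rewrite /= (image_relT _ uv) !orbT. Qed.

Lemma adj_sub3 S1 S2 S3 u v :
  @adj S3 u v -> adj (@sub3 S1 S2 S3 u) (sub3 S1 S2 v).
Proof. by move=> uv; rewrite /= (image_relT _ uv) !orbT. Qed.

(** Each internal vertex is the center of exactly one triangle of the recursion;
    the corner of that triangle with the least label is the neighbor sought. *)
Lemma label_desc R a b c (x : internal R) :
  exists2 y, adj (inr x) y & label a b c x = (vlabel a b c y).+1.
Proof.
elim: R a b c x => [|S1 IH1 S2 IH2 S3 IH3] a b c // [[[x|x]|x]|].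
- have [y xy /= ->] := IH1 (center_label a b c) b c x.
  exists (sub1 S2 S3 y); last by rewrite vlabel_subE.
  exact: adj_sub1 xy.
- have [y xy /= ->] := IH2 a (center_label a b c) c x.
  exists (sub2 S1 S3 y); last by rewrite vlabel_subE.
  exact: adj_sub2 xy.
- have [y xy /= ->] := IH3 a b (center_label a b c) x.
  exists (sub3 S1 S2 y); last by rewrite vlabel_subE.
  exact: adj_sub3 xy.
(* The neighbor below the center is a corner with the least label. *)
have [i min_i] : exists i : 'I_3, nth 0 [:: a; b; c] i = minn a (minn b c).
  have [[ab ac]|[[ba bc]|[ca cb]]] :
    a <= b /\ a <= c \/ b <= a /\ b <= c \/ c <= a /\ c <= b by lia.
  - by exists i1 => /=; lia.
  - by exists i2 => /=; lia.
  - by exists i3 => /=; lia.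
by exists (inl i); rewrite //= min_i.
Qed.

(** Outermost vertices outside [A] have label 1, and descend to any target. *)
Lemma distR_label R (A : {set vertex R}) a b c (x : internal R) :
    maxn a (maxn b c) <= 1 -> (forall y, (y \in A) = (vlabel a b c y == 0)) ->
    minn a (minn b c) = 0 ->
  distR (inr x) A = label a b c x.
Proof.
move=> le1 memA min0.
have near_abc : near a b c by rewrite /near; lia.
apply: (@graph_dist_setE _ _ (vlabel a b c)) => // [u v|]; first exact: vlabel_lip.
case=> [i|u _]; last exact: label_desc.
move=> gt0.
have [j j0] : exists j : 'I_3, nth 0 [:: a; b; c] j = 0.
  have [->|[->|->]] : a = 0 \/ b = 0 \/ c = 0 by lia.
  - by exists i1.
  - by exists i2.
  - by exists i3.
exists (inl j).
  have neq_ij : i != j by apply: contraTneq gt0 => -> /=; rewrite j0.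
  by case: R {A x memA gt0} => [|S1 S2 S3]; rewrite /= neq_ij.
by move: gt0; case: (ord3P i) => -> /=; rewrite j0 /=; lia.
Qed.

Lemma sum_label R a b c : \sum_(x : internal R) label a b c x = label_sum R a b c.
Proof.
elim: R a b c => [|S1 IH1 S2 IH2 S3 IH3] a b c /=; first by rewrite big1 // => -[].
rewrite (bigD1 None) //= -addnA -addnA; congr (_ + _).
rewrite (reindex_omap Some id) => [|[]//] /=.
rewrite (eq_bigl predT) => [|x]; last by rewrite /= eqxx.
by rewrite !big_sumType /= IH1 IH2 IH3 -addnA.
Qed.

Lemma Delta1E R : Delta1 R = label_sum R 0 1 1.
Proof.
rewrite -sum_label; apply: eq_bigr => x _; apply: distR_label => // -[i|y].
  by case: (ord3P i) => ->; rewrite inE.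
by rewrite inE; have [z _ /= ->] := label_desc 0 1 1 y.
Qed.

Lemma Delta2E R : Delta2 R = label_sum R 0 0 1.
Proof.
rewrite -sum_label; apply: eq_bigr => x _; apply: distR_label => // -[i|y].
  by case: (ord3P i) => ->; rewrite !inE.
by rewrite !inE; have [z _ /= ->] := label_desc 0 0 1 y.
Qed.

Lemma Delta3E R : Delta3 R = label_sum R 0 0 0.
Proof.
rewrite -sum_label; apply: eq_bigr => x _; apply: distR_label => // -[i|y].
  by case: (ord3P i) => ->; rewrite !inE.
by rewrite !inE; have [z _ /= ->] := label_desc 0 0 0 y.
Qed.

(** Raising all corners by one raises every internal vertex by one. *)
Lemma label_sumS R a b c :
  label_sum R a.+1 b.+1 c.+1 = label_sum R a b c + rans_order R.
Proof.
elim: R a b c => //= S1 IH1 S2 IH2 S3 IH3 a b c.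
have -> : center_label a.+1 b.+1 c.+1 = (center_label a b c).+1.
  by rewrite /center_label; lia.
by rewrite IH1 IH2 IH3; lia.
Qed.

(** * Renaming the corners *)

(** Since S_i is the sub-RANS opposite to O_i, exchanging two corners also
    exchanges the corresponding two sub-RANS. *)
Fixpoint swap12 (R : rans) : rans :=
  if R is Node S1 S2 S3 then Node (swap12 S2) (swap12 S1) (swap12 S3) else Empty.

Fixpoint swap23 (R : rans) : rans :=
  if R is Node S1 S2 S3 then Node (swap23 S1) (swap23 S3) (swap23 S2) else Empty.

Lemma swap12K : involutive swap12. Proof. by elim=> //= ? -> ? -> ? ->. Qed.
Lemma swap23K : involutive swap23. Proof. by elim=> //= ? -> ? -> ? ->. Qed.

Lemma order_swap12 R : rans_order (swap12 R) = rans_order R.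
Proof. by elim: R => //= ? -> ? -> ? ->; lia. Qed.
Lemma order_swap23 R : rans_order (swap23 R) = rans_order R.
Proof. by elim: R => //= ? -> ? -> ? ->; lia. Qed.

Lemma label_sum_swap12 R a b c : label_sum (swap12 R) a b c = label_sum R b a c.
Proof.
elim: R a b c => //= S1 IH1 S2 IH2 S3 IH3 a b c.
by rewrite IH1 IH2 IH3 /center_label minnCA; lia.
Qed.

Lemma label_sum_swap23 R a b c : label_sum (swap23 R) a b c = label_sum R a c b.
Proof.
elim: R a b c => //= S1 IH1 S2 IH2 S3 IH3 a b c.
by rewrite IH1 IH2 IH3 /center_label (minnC b); lia.
Qed.
(** * Generating functions of weighted classes *)

Section OrdinaryGF.
Local Open Scope ring_scope.
Variable A : comPzRingType.

(** Restricting to a finite sequence of objects makes products of classes plain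
    sequences of pairs, without any bound on the degree. *)
Definition ogf (T : Type) (s : seq T) (sz : T -> nat) (w : T -> A) : fps A :=
  fun n => \sum_(x <- s | sz x == n) w x.

Lemma ogf_mul (T T' : Type) (s : seq T) (s' : seq T') sz sz' w w' :
  (ogf s sz w * ogf s' sz' w')%fps =1
  ogf [seq (x, y) | x <- s, y <- s'] (fun t => sz t.1 + sz' t.2)%N
      (fun t => w t.1 * w' t.2).
Proof.
move=> n; rewrite /ogf /fps_mul [RHS]big_mkcond big_allpairs /=.
under eq_bigr => k _ do rewrite [\sum_(x <- s | _) _]big_mkcond big_distrl /=.
rewrite exchange_big /=; apply: eq_bigr => x _.
have [le_xn|lt_nx] := leqP (sz x) n; last first.
  rewrite !big1 // => [y _|k _]; first by rewrite ifF //; lia.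
  by rewrite ifF ?mul0r //; have := ltn_ord k; lia.
rewrite (bigD1 (inord (sz x))) //= inordK ?ltnS // eqxx big_distrr /=.
rewrite [X in _ + X]big1 => [|k neq_k].
  rewrite addr0 big_mkcond; apply: eq_bigr => y _.
  by congr (if _ then _ else _); lia.
rewrite ifF ?mul0r //; apply: contraNF neq_k => /eqP->.
by rewrite -val_eqE /= inordK.
Qed.

(** A product of series up to degree [N] only involves its factors up to degree
    [N]; this allows replacing the class of all RANS by a finite part of it. *)
Lemma eq_fps_mul (F F' G G' : fps A) N :
    (forall n, (n <= N)%N -> F n = F' n) -> (forall n, (n <= N)%N -> G n = G' n) ->
  forall n, (n <= N)%N -> (F * G)%fps n = (F' * G')%fps n.
Proof.
move=> eqF eqG n le_nN; apply: eq_bigr => k _.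
by rewrite eqF ?eqG //; have := ltn_ord k; lia.
Qed.

(** The factor contributed by the center, put in a form to which [ogf_mul]
    applies. *)
Lemma fps_zc_ogf (c : A) :
  (fps_z * fps_const c)%fps =1 ogf [:: tt] (fun=> 1%N) (fun=> c).
Proof.
move=> n; rewrite /ogf big_mkcond big_seq1 /fps_mul.
case: n => [|n]; first by rewrite big_ord1 mul0r.
rewrite !big_ord_recl big1 => [|k _]; last by rewrite mul0r.
rewrite /fps_z /fps_const /= mul0r mul1r add0r addr0 /bump /= subn1 /=.
by rewrite eqSS (eq_sym 0%N).
Qed.

Lemma uniq_rans_upto N : uniq (rans_upto N).
Proof.
elim: N => //= N IH; apply/andP; split; first by apply/mapP => -[[S1 [S2 S3]]].
rewrite map_inj_uniq => [|[S1 [S2 S3]] [S1' [S2' S3']] /= [-> -> ->]] //.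
by apply: allpairs_uniq => [||[? ?] [? ?]] //; apply: allpairs_uniq => // -[? ?] [? ?].
Qed.

Definition rans_gf (w : rans -> A) : fps A := fun n => \sum_(R : rans_of n) w R.

Lemma rans_gf_upto w N n :
  (n <= N)%N -> rans_gf w n = ogf (rans_upto N) rans_order w n.
Proof.
move=> le_nN; rewrite /rans_gf /ogf -[LHS](big_map (@rans_val n) xpredT w).
rewrite -[RHS]big_filter; apply: perm_big; apply: uniq_perm.
- by rewrite map_inj_uniq ?index_enum_uniq //; apply: val_inj.
- exact/filter_uniq/uniq_rans_upto.
move=> R; rewrite mem_filter; apply/mapP/andP => [[R' _ ->]|[eqR _]].
  have /eqP eqn := rans_valP R'.
  by rewrite eqn eqxx mem_rans_upto // eqn.
by exists (RansOf eqR); rewrite ?mem_index_enum.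
Qed.

Lemma rans_gf_relabel (s : rans -> rans) w :
    involutive s -> (forall R, rans_order (s R) = rans_order R) ->
  rans_gf (w \o s) =1 rans_gf w.
Proof.
move=> sK ord_s n.
have sP (R : rans_of n) : rans_order (s R) == n by rewrite ord_s rans_valP.
rewrite /rans_gf [RHS](reindex_inj (h := fun R => RansOf (sP R))) // => R R' [].
by move/(inv_inj sK)/val_inj.
Qed.

Lemma eq_fps_mull (F F' G : fps A) : F =1 F' -> (F * G)%fps =1 (F' * G)%fps.
Proof. by move=> eqF n; apply: eq_bigr => k _; rewrite eqF. Qed.

(** A RANS is empty or a center with an ordered triple of RANS. *)
Lemma rans_gf_node (w w1 w2 w3 : rans -> A) (c : A) :
    w Empty = 1 ->
    (forall S1 S2 S3, w (Node S1 S2 S3) = c * w1 S1 * w2 S2 * w3 S3) ->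
  rans_gf w =1
    (1 + fps_z * fps_const c * rans_gf w1 * rans_gf w2 * rans_gf w3)%fps.
Proof.
move=> wE wN n; rewrite (rans_gf_upto w (leqnSn n)) /fps_add.
pose G v := ogf (rans_upto n) rans_order v.
have gfE v k : (k <= n)%N -> rans_gf v k = G v k by exact: rans_gf_upto.
have -> : (fps_z * fps_const c * rans_gf w1 * rans_gf w2 * rans_gf w3)%fps n =
    (ogf [:: tt] (fun=> 1%N) (fun=> c) * G w1 * G w2 * G w3)%fps n.
  have zcE k (_ : (k <= n)%N) := fps_zc_ogf c k.
  exact: (eq_fps_mul (eq_fps_mul (eq_fps_mul zcE (gfE w1)) (gfE w2)) (gfE w3)
    (leqnn n)).
rewrite (eq_fps_mull _ (eq_fps_mull _ (ogf_mul _ _ _ _ _ _))).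
rewrite (eq_fps_mull _ (ogf_mul _ _ _ _ _ _)) ogf_mul.
rewrite /ogf big_mkcond [X in _ = _ + X]big_mkcond /= cats0.
rewrite big_cons big_map !big_allpairs big_map /=.
congr (_ + _); first by rewrite wE /fps_const eq_sym.
apply: eq_bigr => S1 _; rewrite big_allpairs; apply: eq_bigr => S2 _.
apply: eq_bigr => S3 _; rewrite wN /=.
by congr (if _ == _ then _ else _); lia.
Qed.

End OrdinaryGF.

Local Open Scope ring_scope.

(** * The topological generating function *)

Definition weight (p1 p2 p3 : poly3) (R : rans) : poly3 :=
  p1 ^+ label_sum R 0 1 1 * p2 ^+ label_sum R 0 0 1 * p3 ^+ label_sum R 0 0 0.

Lemma DeltaE : Delta =1 rans_gf (weight d1 d2 d3).
Proof. by move=> n; apply: eq_bigr => R _; rewrite Delta1E Delta2E Delta3E. Qed.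

Lemma fps_subst_Delta q p1 p2 p3 :
  fps_subst Delta q p1 p2 p3 =1
  rans_gf (fun R => weight p1 p2 p3 R * q ^+ rans_order R).
Proof.
move=> n; rewrite /fps_subst DeltaE /rans_gf raddf_sum mulr_suml.
apply: eq_bigr => R _; rewrite (eqP (rans_valP R)) /weight.
by rewrite /= !rmorphM !rmorphXn /= /d1 /d2 /d3 !comp_mpolyXU.
Qed.

Definition swap13 (R : rans) : rans := swap12 (swap23 (swap12 R)).

Lemma swap13K : involutive swap13.
Proof. by move=> R; rewrite /swap13 swap12K swap23K swap12K. Qed.

Lemma order_swap13 R : rans_order (swap13 R) = rans_order R.
Proof. by rewrite /swap13 order_swap12 order_swap23 order_swap12. Qed.

Lemma label_sum_swap13 R a b c : label_sum (swap13 R) a b c = label_sum R c b a.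
Proof. by rewrite /swap13 label_sum_swap12 label_sum_swap23 label_sum_swap12. Qed.

(** The reflection [swap23] of the whole RANS, which fixes Delta_(1) and
    Delta_(3) and turns the target set of Delta_(2) into O_1 and O_3, serves to
    obtain the last two factors in the stated order: after it, S2 has the
    statistics (Delta_(1), Delta_(2), Delta_(2)) up to renaming, and S3 has
    (Delta_(1), Delta_(1), Delta_(2)). *)
Lemma weight_node S1 S2 S3 :
  weight d1 d2 d3 (swap23 (Node S1 S2 S3)) =
  d1 * d2 * d3 *
  (weight d2 d3 d1 (swap13 S1) * d1 ^+ rans_order (swap13 S1)) *
  weight d1 (d2 * d3) 1 (swap23 S2) * weight (d1 * d2) d3 1 S3.
Proof.
rewrite /weight !label_sum_swap23 !label_sum_swap13 order_swap13 /=.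
rewrite !label_sumS !exprD !exprMn !expr1n; ring.
Qed.

Theorem proposition4p2 :
  Delta =1 (1 + fps_z * fps_const (d1 * d2 * d3)
              * fps_subst Delta d1 d2 d3 d1
              * fps_subst Delta 1 d1 (d2 * d3) 1
              * fps_subst Delta 1 (d1 * d2) d3 1)%fps.
Proof.
move=> n; rewrite DeltaE -(rans_gf_relabel _ swap23K order_swap23).
rewrite (rans_gf_node (w := _ \o _) _ weight_node) //=; last first.
  by rewrite /weight /= !expr0 !mulr1.
rewrite /fps_add; congr (_ + _).
apply: (@eq_fps_mul _ _ _ _ _ n) => // [k le_kn|k le_kn].
  apply: (@eq_fps_mul _ _ _ _ _ n) => // [j le_jn|j le_jn].
    apply: (@eq_fps_mul _ _ _ _ _ n) => // i le_in; rewrite fps_subst_Delta.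
    exact: (rans_gf_relabel (fun R => _ * _ ^+ rans_order R) swap13K order_swap13).
  rewrite fps_subst_Delta (rans_gf_relabel _ swap23K order_swap23).
  by apply: eq_bigr => R _; rewrite expr1n mulr1.
by rewrite fps_subst_Delta; apply: eq_bigr => R _; rewrite expr1n mulr1.
Qed.
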